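(* Let $\epsilon=\epsilon(n)>0$ be such that $\epsilon\gg n^{-1/3}\log^{1/3}n$. Then w.h.p. $\mathcal{G}\big(n,p=2(1+\epsilon)/n,2\big)$ contains an alternating path of length at least $\epsilon^2n/5$.
   Context: $\mathcal{G}(n,p,2)$ is the random pair $(G,c)$ in which each possible edge on $n$ vertices is included independently with probability $p$ and assigned a uniformly random color from a set of two colors, $\{red,blue\}$; $c$ denotes the resulting edge coloring. A path $v_1v_2\cdots v_l$ is alternating if $c(v_{t-1}v_t)\neq c(v_tv_{t+1})$ for all $2\le t\le l-1$. A sequence of events $A_n$ occurs with high probability (w.h.p.) if $\lim_{n\to\infty}\mathbb{P}[A_n]=1$. The notation $a_n\gg b_n$ means $a_n/b_n\to\infty$ as $n\to\infty$.
   Formalization: The formal statement requires ε(n) ≤ ε0 for all large n, for some absolute constant ε0 > 0; without an upper bound the claim is false (ε = 3 would require a path of length 9n/5 on n vertices). *)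

(* Defs.v *)
From HB Require Import structures.
From mathcomp Require Import all_boot all_order all_algebra.
From mathcomp Require Import all_classical all_reals all_analysis.
Set Implicit Arguments.
Unset Strict Implicit.
Unset Printing Implicit Defensive.
Import Order.TTheory GRing.Theory Num.Theory.
Import numFieldNormedType.Exports.
Local Open Scope classical_set_scope.
Local Open Scope ring_scope.

(* The two colors: red is [true], blue is [false]. *)
Notation color := bool (only parsing).

Definition vpair (n : nat) := {e : {set 'I_n} | #|e| == 2}.

(* An outcome (G, c): a pair mapped to [None] is not an edge of G, a pair
   mapped to [Some x] is an edge of color x. *)
Definition cgraph (n : nat) := {ffun vpair n -> option color}.

(* [None] when uv is not an edge, in particular when u = v. *)
Definition ecolor (n : nat) (g : cgraph n) (u v : 'I_n) : option color :=
  obind g (insub [set u; v]%SET).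

Definition adj (n : nat) (g : cgraph n) : rel 'I_n :=
  fun u v => ecolor g u v != None.

(* The path v_1 v_2 ... v_l is given as v = v_1 and s = [:: v_2; ...; v_l]; its
   length, i.e. its number of edges, is [size s]. *)
Definition alternating_path (n : nat) (g : cgraph n) (v : 'I_n)
    (s : seq 'I_n) : bool :=
  [&& uniq (v :: s), path (adj g) v s
    & sorted (fun x y => x != y) (pairmap (ecolor g) v s)].

Section Probability.
Variable R : realType.

Definition pair_weight (p : R) (o : option color) : R :=
  if o is Some _ then p / 2 else 1 - p.

(* The law of G(n,p,2). Total in p, but a probability only for
   0 <= p <= 1; p = 2 (1 + eps) / n may leave this range for small n. *)
Definition cgraph_weight (n : nat) (p : R) (g : cgraph n) : R :=
  \prod_(e : vpair n) pair_weight p (g e).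

Definition Pr (n : nat) (p : R) (A : set (cgraph n)) : R :=
  \sum_(g : cgraph n | `[< A g >]) cgraph_weight p g.

Lemma cgraph_weight_ge0 (n : nat) (p : R) (g : cgraph n) :
  0 <= p <= 1 -> 0 <= cgraph_weight p g.
Proof.
case/andP=> p0 p1; apply: prodr_ge0 => e _.
by case: (g e) => [_|] /=; rewrite ?divr_ge0 ?subr_ge0.
Qed.

Lemma Pr_setT (n : nat) (p : R) : Pr p [set: cgraph n] = 1.
Proof.
rewrite /Pr (eq_bigl xpredT); last by move=> g; apply/asboolP.
rewrite -(bigA_distr_bigA (fun=> pair_weight p)) big1 // => e _.
rewrite (bigD1 None) //= (bigD1 (Some true)) //= (bigD1 (Some false)) //=.
by rewrite big1 => [|[[]|]] //; rewrite addr0 -splitr subrK.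
Qed.

Definition whp (A : forall n, set (cgraph n)) (p : nat -> R) : Prop :=
  Pr (p n) (A n) @[n --> \oo] --> (1 : R).

Definition much_greater (a b : nat -> R) : Prop :=
  a n / b n @[n --> \oo] --> +oo.

End Probability.

(* Main.v *)
(* Depth-first search in the style of Krivelevich and Sudakov.  The stack is an
   alternating path; its top vertex asks, one pair at a time, whether a fresh
   vertex is joined to it by an edge of the color prescribed by the parity of
   the depth, so each question succeeds with probability q = p/2 = (1+eps)/n
   independently of the past.  A vertex is finished once all
   its pairs with fresh vertices have been asked, hence
   #finished * #fresh <= #questions.
   After eps n^2 / 2 questions, Chebyshev gives eps (1+eps) n / 2 - o(eps^2 n)
   successes.  If the stack has fewer than eps^2 n / 5 + 1 vertices then at
   least eps n / 2 + 0.275 eps^2 n vertices are finished, and the product above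
   exceeds eps n^2 / 2, a contradiction. *)
Require Import Defs.
From HB Require Import structures.
From mathcomp Require Import all_boot all_order all_algebra.
From mathcomp Require Import all_classical all_reals all_analysis.
From mathcomp Require Import zify ring lra.
Set Implicit Arguments.
Unset Strict Implicit.
Unset Printing Implicit Defensive.
Import Order.TTheory GRing.Theory Num.Theory.
Import numFieldNormedType.Exports.
Local Open Scope classical_set_scope.
Local Open Scope ring_scope.

(** * Expectation under the law of G(n,p,2) *)

Section Expectation.
Variables (R : realType) (n : nat) (p : R).

Definition Ex (f : cgraph n -> R) : R := \sum_g cgraph_weight p g * f g.

Lemma ExD f h : Ex (fun g => f g + h g) = Ex f + Ex h.
Proof. by rewrite -big_split; apply: eq_bigr => g _; rewrite mulrDr. Qed.

Lemma eq_Ex f h : f =1 h -> Ex f = Ex h.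
Proof. by move=> fh; apply: eq_bigr => g _; rewrite fh. Qed.

Lemma Ex_cst a : Ex (fun=> a) = a.
Proof.
rewrite /Ex -mulr_suml -[RHS]mul1r -(Pr_setT n p) /Pr; congr (_ * _).
by apply: eq_bigl => g; apply/esym/asboolP.
Qed.

Lemma ExZ a f : Ex (fun g => a * f g) = a * Ex f.
Proof. by rewrite /Ex mulr_sumr; apply: eq_bigr => g _; rewrite mulrCA. Qed.

Lemma le_Ex f h : 0 <= p <= 1 -> (forall g, f g <= h g) -> Ex f <= Ex h.
Proof.
move=> p01 fh; apply: ler_sum => g _.
by rewrite ler_wpM2l ?cgraph_weight_ge0.
Qed.

Lemma Pr_Ex (A : set (cgraph n)) : Pr p A = Ex (fun g => (`[< A g >])%:R).
Proof.
rewrite /Pr big_mkcond; apply: eq_bigr => g _.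
by case: `[< A g >]; rewrite ?mulr1 ?mulr0.
Qed.

Lemma sum_pair_weight (phi : option color -> R) :
  \sum_o pair_weight p o * phi o =
  (1 - p) * phi None + p / 2 * phi (Some true) + p / 2 * phi (Some false).
Proof.
rewrite (bigD1 None) //= (bigD1 (Some true)) //= (bigD1 (Some false)) //=.
by rewrite big1 => [|[[]|]] //; rewrite addr0 addrA.
Qed.

Definition recolor (e : vpair n) (o : option color) (g : cgraph n) : cgraph n :=
  [ffun e' => if e' == e then o else g e'].

(** Invariance under [recolor e] says that [h] never reads the color of [e], which is independent of
    all other colors. *)
Lemma Ex_indep e (phi : option color -> R) (h : cgraph n -> R) :
  (forall g o, h (recolor e o g) = h g) ->
  Ex (fun g => phi (g e) * h g) = (\sum_o pair_weight p o * phi o) * Ex h.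
Proof.
move=> hP.
(* [C] averages [h] over the colors of all pairs but [e]. *)
pose C := \sum_(g : cgraph n | g e == None)
            (\prod_(e' | e' != e) pair_weight p (g e')) * h g.
(* The case [psi = 1] identifies [C] with [Ex h], since the weights of one pair sum to 1. *)
suff key psi : Ex (fun g => psi (g e) * h g)
    = (\sum_o pair_weight p o * psi o) * C.
  have -> : Ex h = C; last exact: key.
  transitivity (Ex (fun g => 1 * h g)); first by apply: eq_Ex => g; rewrite mul1r.
  by rewrite (key (fun=> 1)) sum_pair_weight !mulr1 -addrA -splitr subrK mul1r.
rewrite /Ex (partition_big (fun g : cgraph n => g e) xpredT) //= mulr_suml.
apply: eq_bigr => o _; rewrite /C mulr_sumr.
(* Each class [g e = o] is parametrized by the outcomes in which [e] is absent. *)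
rewrite (reindex_onto (recolor e o) (recolor e None)) /=; last first.
  move=> g /eqP go; apply/ffunP => e'; rewrite !ffunE.
  by case: eqP => // ->.
apply: eq_big => [g|g].
  rewrite !ffunE !eqxx /=; apply/eqP/eqP => [<-|ge]; first by rewrite !ffunE eqxx.
  by apply/ffunP => e'; rewrite !ffunE; case: eqP => // ->.
rewrite hP ffunE eqxx => _.
rewrite /cgraph_weight (bigD1 e) //= ffunE eqxx.
under eq_bigr => e' ne do rewrite ffunE (negbTE ne).
ring.
Qed.

End Expectation.

(** * The search and its transitions *)

Section DFS.
Variables (n m N0 : nat).

(** [hits] counts successful questions, not pushes: a restart on an empty stack pushes a vertex
    without asking anything. *)
Record dfs := Dfs {
  stk : seq 'I_n;
  fresh : {set 'I_n};
  asked : {set vpair n};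
  hits : nat }.

(* The finished vertices are those neither fresh nor on the stack. *)
Definition ndone s := (n - (#|fresh s| + size (stk s)))%N.

(* Stopping at m finished vertices bounds #finished from above, so that the
   product #finished * #fresh is controlled by its values at both ends. *)
Definition halted s := (m <= ndone s)%N || (N0 <= #|asked s|)%N.

Definition candidate s : option ('I_n * vpair n) :=
  if halted s then None else
  if stk s is v :: _ then
    [pick x : 'I_n * vpair n |
      [&& x.1 \in fresh s, x.2 \notin asked s & val x.2 == [set v; x.1]%SET]]
  else None.

Definition move s : dfs :=
  if halted s then s else
  if stk s is _ :: l then Dfs l (fresh s) (asked s) (hits s)
  else if [pick u in fresh s] is Some u
       then Dfs [:: u] (fresh s :\ u)%SET (asked s) (hits s) else s.

Definition answer s (x : 'I_n * vpair n) (b : bool) : dfs :=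
  if b then Dfs (x.1 :: stk s) (fresh s :\ x.1)%SET (x.2 |: asked s)%SET (hits s).+1
  else Dfs (stk s) (fresh s) (x.2 |: asked s)%SET (hits s).

Definition step (g : cgraph n) s : dfs :=
  if candidate s is Some x
  then answer s x (g x.2 == Some (odd (size (stk s)))) else move s.

Definition run k g s := iter k (step g) s.

Lemma candidateP s u e : candidate s = Some (u, e) ->
  exists v l, [/\ ~~ halted s, stk s = v :: l, u \in fresh s, e \notin asked s
    & val e = [set v; u]%SET].
Proof.
rewrite /candidate; case: ifP => // /negbT hs; case: (stk s) => // v l.
by case: pickP => // -[u' e'] /and3P[? ? /eqP ?] [<- <-]; exists v, l.
Qed.

Lemma asked_move s : asked (move s) = asked s.
Proof.
by rewrite /move; case: ifP => // _; case: (stk s) => [|//]; case: pickP.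
Qed.

Lemma hits_move s : hits (move s) = hits s.
Proof.
by rewrite /move; case: ifP => // _; case: (stk s) => [|//]; case: pickP.
Qed.

Lemma asked_answer s x b : asked (answer s x b) = (x.2 |: asked s)%SET.
Proof. by case: b. Qed.

Lemma hits_answer s x b : hits (answer s x b) = (hits s + b)%N.
Proof. by case: b; rewrite /= ?addn1 ?addn0. Qed.

(** No pair is asked twice, so the rest of the run ignores the color of a pair already asked. *)
Lemma run_recolor k s e o g :
  e \in asked s -> run k (recolor e o g) s = run k g s.
Proof.
rewrite /run; elim: k s => // k IH s es; rewrite !iterSr.
have -> : step (recolor e o g) s = step g s.
  rewrite /step; case E: candidate => [[u e']|//] /=.
  have [v [l [_ _ _ ne _]]] := candidateP E.
  by rewrite ffunE; case: (e' =P e) ne => // ->; rewrite es.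
apply: IH; rewrite /step; case: candidate => [x|].
  by rewrite asked_answer !inE es orbT.
by rewrite asked_move.
Qed.

(** * Second moment of the number of successes *)

Section Martingale.
Variables (R : realType) (p : R).

Definition excess s : R := (hits s)%:R - p / 2 * #|asked s|%:R.

(* A martingale along the search, compensating the square of [excess]. *)
Definition compensated s : R :=
  excess s ^+ 2 - p / 2 * (1 - p / 2) * #|asked s|%:R.

(** Induction by peeling off the first step, whence the arbitrary start [s]. After the first
    question the run no longer reads the pair asked, so its answer is independent of the rest; it
    succeeds with probability p/2 whichever color is prescribed. *)
Lemma Ex_compensated k s : Ex p (fun g => compensated (run k g s)) = compensated s.
Proof.
elim: k s => [|k IH] s; first by rewrite /run /= Ex_cst.
under eq_Ex => g do rewrite /run iterSr -/(run k g _) /step.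
case E: (candidate s) => [x|]; last first.
  by rewrite IH /compensated /excess asked_move hits_move.
set c := Some _.
have [v [l [_ _ _ ne _]]] : exists v l, [/\ ~~ halted s, stk s = v :: l,
    x.1 \in fresh s, x.2 \notin asked s & val x.2 = [set v; x.1]%SET].
  by apply: candidateP; rewrite E -surjective_pairing.
pose F b g := compensated (run k g (answer s x b)).
have FP b g o : F b (recolor x.2 o g) = F b g.
  by rewrite /F run_recolor // asked_answer setU11.
transitivity (Ex p (fun g => (g x.2 == c)%:R * F true g + (g x.2 != c)%:R * F false g)).
  by apply: eq_Ex => g; rewrite /F; case: eqP; rewrite /= ?mul1r ?mul0r ?addr0 ?add0r.
rewrite ExD.
rewrite (@Ex_indep _ _ p _ (fun o => (o == c)%:R)) //.
rewrite (@Ex_indep _ _ p _ (fun o => (o != c)%:R)) //.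
rewrite /F !IH !sum_pair_weight /compensated /excess !asked_answer !hits_answer.
rewrite cardsU1 ne natrD addn0 /= natrD.
by rewrite /c; case: (odd _) => /=; field.
Qed.

End Martingale.

(** * Invariants of the search *)

Fixpoint alternating (g : cgraph n) (l : seq 'I_n) : bool :=
  if l is v :: l' then
    (if l' is w :: _ then ecolor g v w == Some (odd (size l')) else true)
    && alternating g l'
  else true.

(** Each edge has the color given by the parity of the number of vertices below it on the stack, so
    consecutive edges differ. *)
Lemma alternating_alternating_path g v l :
  uniq (v :: l) -> alternating g (v :: l) -> alternating_path g v l.
Proof.
rewrite /alternating_path => -> /=; elim: l v => //= w l IH v.
case/andP=> /eqP cvw aw; have /andP[-> ss] := IH w aw.
rewrite /adj cvw /=; case: l aw ss {IH cvw} => //= x l /andP[/eqP -> _] ->.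
by rewrite andbT; case: (odd _).
Qed.

Record invariant (g : cgraph n) s : Prop := Invariant {
  inv_uniq : uniq (stk s);
  inv_stk_fresh : {in stk s, forall v, v \notin fresh s};
  inv_alternating : alternating g (stk s);
  inv_separated : forall v u, v \notin stk s -> v \notin fresh s ->
    u \in fresh s -> exists2 e, e \in asked s & val e = [set v; u]%SET;
  inv_hits : (hits s + #|fresh s| <= n)%N;
  inv_ndone : (ndone s <= m)%N;
  inv_asked : (#|asked s| <= N0)%N }.

Lemma candidateN s v l u e : ~~ halted s -> candidate s = None ->
  stk s = v :: l -> u \in fresh s -> val e = [set v; u]%SET -> e \in asked s.
Proof.
rewrite /candidate => /negbTE -> + sE; rewrite sE.
case: pickP => // none _ us eE; apply: contraFT (none (u, e)) => ne.
by rewrite /= us ne eE eqxx.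
Qed.

Lemma invariant_step g s : invariant g s -> invariant g (step g s).
Proof.
case=> un sf al sep hi nd ak; rewrite /step.
case E: candidate => [[u e]|].
  have [v [l [hs sE us ne eE]]] := candidateP E.
  move: hs; rewrite negb_or -!ltnNge => /andP[hm hN].
  have fu : #|fresh s| = #|(fresh s :\ u)%SET|.+1 by rewrite (cardsD1 u) us.
  rewrite /answer; case: eqP => /= ge; split => //=.
  - by rewrite un andbT; apply: contraL us => /sf.
  - move=> w; rewrite !inE => /orP[/eqP ->|/sf/negbTE ->]; last by rewrite andbF.
    by rewrite eqxx.
  - by rewrite al andbT -ge sE /ecolor finset.setUC -eE valK /=.
  - move=> w x; rewrite !inE !negb_or negb_and negbK => /andP[wu ws].
    rewrite (negbTE wu) /= => wf /andP[_ xf].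
    by have [e' e's e'E] := sep w x ws wf xf; exists e'; rewrite ?inE ?e's ?orbT.
  - by rewrite addSnnS -fu.
  - by rewrite /ndone /= addnS -addSn -fu.
  - by rewrite cardsU1 ne.
  - move=> w x ws wf xf.
    by have [e' e's e'E] := sep w x ws wf xf; exists e'; rewrite ?inE ?e's ?orbT.
  - by rewrite cardsU1 ne.
rewrite /move; case: ifP => // /negbT hs.
have [hm hN] : (ndone s < m)%N /\ (#|asked s| < N0)%N.
  by move: hs; rewrite negb_or -!ltnNge => /andP[].
case sE: (stk s) => [|v l].
  case: pickP => [u us|]; last by split.
  have fu : #|fresh s| = #|(fresh s :\ u)%SET|.+1 by rewrite (cardsD1 u) us.
  split => //=.
  - by move=> w; rewrite !inE => /eqP ->; rewrite eqxx.
  - move=> w x; rewrite !inE negb_and negbK => wu.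
    rewrite (negbTE wu) /= => wf /andP[_ xf].
    by apply: sep => //; rewrite sE.
  - by rewrite (leq_trans _ hi) // leq_add2l fu.
  - by move: nd; rewrite /ndone sE addn0 fu addn1.
rewrite sE in un sf al sep.
have vf : v \notin fresh s by apply: sf; rewrite mem_head.
split => //=.
- by case/andP: un.
- by move=> w wl; apply: sf; rewrite inE wl orbT.
- by case/andP: al.
(* Only the popped [v] is newly finished; as no candidate was left, all its pairs with fresh
   vertices have been asked. *)
- move=> w u wl wf uf; have [->|wv] := eqVneq w v; last first.
    by apply: sep => //; rewrite inE negb_or wv.
  have e2 : #|[set v; u]%SET| == 2.
    by rewrite cards2 (_ : v != u) //; apply: contraNneq vf => ->.
  exists (exist (fun e : {set 'I_n} => is_true (#|e| == 2)) _ e2) => //.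
  exact: (candidateN hs E sE uf).
- by move: hm; rewrite /ndone sE /=; lia.
Qed.

(** * Termination *)

Definition potential s := (2 * #|fresh s| + size (stk s) + #|~: asked s|)%N.

Lemma halted_step g s : halted s -> step g s = s.
Proof. by move=> hs; rewrite /step /candidate /move hs. Qed.

(** Fresh vertices weigh 2, so a push lowers the potential although the stack grows; a pop shortens
    the stack, and a failed question uses up a pair. *)
Lemma potential_step g s : (m <= n)%N -> invariant g s -> ~~ halted s ->
  (potential (step g s) < potential s)%N.
Proof.
move=> mn [un sf _ _ _ _ _] hs.
rewrite /step /potential; case E: candidate => [[u e]|].
  have [v [l [_ sE us ne eE]]] := candidateP E.
  have fu : #|fresh s| = #|(fresh s :\ u)%SET|.+1 by rewrite (cardsD1 u) us.
  have fe : #|(~: asked s)%SET| = #|((~: asked s) :\ e)%SET|.+1.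
    by rewrite (cardsD1 e) finset.in_setC ne.
  have -> : (#|~: asked (answer s (u, e) (g e == Some (odd (size (stk s)))))| =
    #|(~: asked s) :\ e|)%N.
    by rewrite asked_answer finset.setCU finset.setIC -finset.setDE.
  rewrite fe /answer; case: ifP => _ /=; rewrite ?fu;
    by move: #|(fresh s :\ u)%SET| #|((~: asked s) :\ e)%SET| (size _); lia.
rewrite asked_move /move (negbTE hs); case sE: (stk s) => [|v l] /=; last first.
  by move: #|fresh s| #|~: asked s| (size l); lia.
case: pickP => [u us|f0] /=.
  have -> : #|fresh s| = #|(fresh s :\ u)%SET|.+1 by rewrite (cardsD1 u) us.
  by move: #|(fresh s :\ u)%SET| #|~: asked s|; lia.
(* With an empty stack and no fresh vertex, all [n >= m] vertices are finished, so the search would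
   have halted. *)
have f00 : #|fresh s| = 0%N by apply: eq_card0 => x; exact: f0.
by move: hs; rewrite /halted /ndone f00 sE subn0 mn.
Qed.

Lemma invariant_run g k s : invariant g s -> invariant g (run k g s).
Proof. by move=> is_; elim: k => //= k; apply: invariant_step. Qed.

Lemma halted_run g k s : (m <= n)%N -> invariant g s -> (potential s <= k)%N ->
  halted (run k g s).
Proof.
move=> mn; elim: k s => [|k IH] s is_ pk.
  by apply: contraT => /(potential_step mn is_); lia.
have [hs|hs] := boolP (halted s).
  by rewrite /run; elim: k.+1 => //= j hj; rewrite halted_step.
rewrite /run iterSr; apply: IH; first exact: invariant_step.
by have := potential_step mn is_ hs; lia.
Qed.

(** * Counting finished vertices and questions *)

Lemma ndoneE g s : invariant g s ->
  ndone s = #|~: (fresh s :|: [set v in stk s])| /\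
  (ndone s + #|fresh s| + size (stk s) = n)%N.
Proof.
case=> un sf _ _ _ _ _.
have c : #|fresh s :|: [set v in stk s]| = (#|fresh s| + size (stk s))%N.
  rewrite cardsU cardsE (card_uniqP un) (_ : _ :&: _ = finset.set0)%SET ?cards0 ?subn0 //.
  by apply/setP => v; rewrite !inE; apply/andP => -[vf /sf]; rewrite vf.
have := cardsC (fresh s :|: [set v in stk s]); rewrite c card_ord /ndone.
by move: #|~: _| => d; lia.
Qed.

(** Finished and fresh vertices are disjoint, so an unordered pair determines its finished and its
    fresh end: the product injects into the asked pairs. *)
Lemma ndone_fresh_asked g s : invariant g s ->
  (ndone s * #|fresh s| <= #|asked s|)%N.
Proof.
move=> is_; have [-> _] := ndoneE is_; case: is_ => _ _ _ sep _ _ _.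
rewrite -cardsX -(card_in_imset (f := fun x => [set x.1; x.2]%SET)).
  rewrite -(card_imset (asked s) val_inj); apply/subset_leq_card/fintype.subsetP.
  move=> _ /imsetP[[v u] + ->]; rewrite !inE negb_or => /andP[/andP[vf vs] uf].
  by have [e es <-] := sep v u vs vf uf; apply: imset_f.
move=> -[v u] [v' u']; rewrite !inE /= !negb_or => /andP[/andP[vf _] uf].
case/andP => /andP[v'f _] u'f /setP vu.
have : v \in [set v'; u']%SET by rewrite -vu !inE eqxx.
have : u \in [set v'; u']%SET by rewrite -vu !inE eqxx orbT.
rewrite !inE => /orP[/eqP uv'|/eqP ->] /orP[/eqP ->|/eqP vu'] //.
- by rewrite uv' (negbTE v'f) in uf.
- by rewrite uv' (negbTE v'f) in uf.
- by rewrite vu' u'f in vf.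
Qed.

Definition dfs_init := Dfs [::] [set: 'I_n] finset.set0 0.

Lemma invariant_init g : invariant g dfs_init.
Proof.
split => //=; rewrite ?cards0 //.
- by move=> v u _; rewrite inE.
- by rewrite cardsT card_ord.
- by rewrite /ndone cardsT card_ord addn0 subnn.
Qed.

Lemma dfs_final g : (m <= n)%N ->
  let s := run (potential dfs_init) g dfs_init in invariant g s /\ halted s.
Proof.
by move=> mn; split; [apply/invariant_run/invariant_init
                     |apply/halted_run => //; apply: invariant_init].
Qed.

End DFS.

(** * Concentration and the numerical contradiction *)

Lemma excess_deviation (R : realType) (n m N0 k : nat) (p delta : R) :
  0 <= p <= 1 -> 0 < delta ->
  Ex p (fun g : cgraph n =>
    (delta < `|excess p (run m N0 k g (dfs_init n))|)%R%:R) <= p / 2 * N0%:R / delta ^+ 2.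
Proof.
move=> /[dup] p01 /andP[p0 p1] d0.
rewrite ler_pdivlMr ?exprn_gt0 // mulrC -ExZ.
pose c g := compensated p (run m N0 k g (dfs_init n)).
(* Chebyshev: [compensated] has mean 0, and adding p/2 times [N0] to it dominates the square of
   [excess], since at most [N0] pairs are asked. *)
apply: (@le_trans _ _ (Ex p (fun g => c g + p / 2 * N0%:R))).
  apply: le_Ex => // g.
  have asked_le := inv_asked (invariant_run k (invariant_init m N0 g)).
  set s := run _ _ _ _ _ in asked_le *; rewrite /c /compensated -/s.
  have {}asked_le : #|asked s|%:R <= N0%:R :> R by rewrite ler_nat.
  have a0 : 0 <= #|asked s|%:R :> R by [].
  apply: (@le_trans _ _ (excess p s ^+ 2)); last first.
    have : 0 <= p / 2 * (N0%:R - #|asked s|%:R) by rewrite mulr_ge0 ?subr_ge0 ?divr_ge0.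
    have : 0 <= (p / 2) ^+ 2 * #|asked s|%:R by rewrite mulr_ge0 ?sqr_ge0.
    by lra.
  case: ltP => [lt|_] /=; last by rewrite mulr0 sqr_ge0.
  by rewrite mulr1 -[leRHS]real_normK ?num_real // ler_pXn2r ?nnegrE ?(ltW lt) ?(ltW d0).
rewrite ExD Ex_compensated Ex_cst /compensated /excess /= cards0.
by rewrite !mulr0 !subr0 expr0n /= add0r.
Qed.

(** To be read with x = n, y = eps n, z = eps^2 n, [d] finished vertices and [l] on the stack. At
    the least [d], the product exceeds x y / 2 by (11/40 - 1/4) x z, up to y z and z z terms that
    are too small to cancel this. *)
Lemma separated_product_gt (R : realType) (x y z d l : R) :
  0 < x -> 0 < y -> 0 < z -> y * y = x * z -> y <= x / 50 -> z <= y / 50 ->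
  y / 2 + 11 / 40 * z <= d -> d <= x / 3 -> l <= 9 / 40 * z ->
  x * y / 2 < d * (x - l - d).
Proof.
move=> x0 y0 z0 yyE yx zy lod dm lz.
set lo := y / 2 + 11 / 40 * z in lod.
have lo0 : 0 <= lo by rewrite /lo; lra.
(* The parabola in [d] is compared at two points whose sum stays below x - l, thanks to
   [d <= x / 3]. *)
have mono : lo * (x - l - lo) <= d * (x - l - d).
  rewrite -subr_ge0; have -> : d * (x - l - d) - lo * (x - l - lo) =
    (d - lo) * (x - l - lo - d) by ring.
  by rewrite mulr_ge0 ?subr_ge0 // /lo; lra.
apply: lt_le_trans mono.
apply: (@lt_le_trans _ _ (lo * (x - 9 / 40 * z - lo))); last first.
  by rewrite ler_wpM2l //; lra.
have -> : lo * (x - 9 / 40 * z - lo) =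
  x * y / 2 + 11 / 40 * (x * z) - y * y / 4 - 31 / 80 * (y * z)
    - 11 / 80 * (z * z) by rewrite /lo; field.
have xz : 0 < x * z by rewrite mulr_gt0.
have yz : y * z <= (x * z) / 50 by rewrite mulrAC ler_pM2r.
have zz : z * z <= (x * z) / 50 by rewrite mulrAC ler_pM2r //; lra.
rewrite yyE.
by move: (x * y / 2) (x * z) (y * z) (z * z) xz yz zz => *; lra.
Qed.

Lemma short_stack_deviation (R : realType) (n d f l h a : nat) (e : R) :
  let N0 := Num.truncn (e * n%:R ^+ 2 / 2) in
  0 < e <= 1 / 50 -> 1000 <= e ^+ 2 * n%:R ->
  (d + f + l = n)%N -> (h + f <= n)%N -> (d <= n %/ 3)%N ->
  (d * f <= a)%N -> (a <= N0)%N -> (n %/ 3 <= d)%N \/ (N0 <= a)%N ->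
  l%:R < e ^+ 2 * n%:R / 5 + 1 ->
  e ^+ 2 * n%:R / 50 < `|h%:R - (2 * (1 + e) / n%:R) / 2 * a%:R|.
Proof.
move=> N0 /andP[e0 e1] big dfl hf dm dfa aN stop short.
have n0 : 0 < n%:R :> R by rewrite ltr0n lt0n; apply/eqP => n0; rewrite n0 mulr0 in big; lra.
rewrite ltNge; apply/negP; rewrite ler_norml => /andP[dev _].
have Nlt : e * n%:R ^+ 2 / 2 < N0%:R + 1.
  by rewrite natr1 Num.Theory.truncnS_gt.
have Nle : N0%:R <= e * n%:R ^+ 2 / 2 by rewrite Num.Theory.truncn_le // divr_ge0 ?mulr_ge0 ?ltW.
have Rdfl : d%:R + f%:R + l%:R = n%:R :> R by rewrite -!natrD dfl.
have Rhf : h%:R + f%:R <= n%:R :> R by rewrite -natrD ler_nat.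
have Rdm : d%:R <= (n %/ 3)%:R :> R by rewrite ler_nat.
have Rdfa : d%:R * f%:R <= a%:R :> R by rewrite -natrM ler_nat.
have RaN : a%:R <= N0%:R :> R by rewrite ler_nat.
have mle : (n %/ 3)%:R * 3 <= n%:R :> R by rewrite -natrM ler_nat leq_trunc_div.
have mge : n%:R <= (n %/ 3)%:R * 3 + 3 :> R.
  by rewrite -natrM -natrD ler_nat -mulSnr ltnW // ltn_ceil.
move: (N0) (n%:R : R) => N x in stop n0 big Nlt Nle Rdfl Rhf RaN mle mge short dev *.
pose y := e * x; pose z := e ^+ 2 * x.
have z0 : 0 < z by rewrite /z mulr_gt0 ?exprn_gt0.
have yx : y <= x / 50 by rewrite /y mulrC ler_pM2l // -div1r.
have y0 : 0 < y by rewrite mulr_gt0.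
have zy : z <= y / 50.
  have -> : z = y * e by rewrite /y /z; ring.
  by rewrite ler_pM2l // -div1r.
have yyE : y * y = x * z by rewrite /y /z; ring.
rewrite -/z in big short dev.
have {}Nlt : x * y / 2 < N%:R + 1 by move: Nlt; rewrite /y; lra.
have {}Nle : N%:R <= x * y / 2 by move: Nle; rewrite /y; lra.
(* From the 1/2 in the mean number of successes, 1/5 goes to the stack and 1/50 to the deviation,
   leaving 7/25; the spare z/200 over 11/40 absorbs a rounding loss of 2, as z is at least 1000. *)
pose lo := y / 2 + 11 / 40 * z.
have lod : lo <= d%:R.
  rewrite /lo; case: stop => [md|Na].
    have : (n %/ 3)%:R <= d%:R :> R by rewrite ler_nat.
    by lra.
  have {}Na : N%:R <= a%:R :> R by rewrite ler_nat.
  have aE : y / 2 + z / 2 - 1 <= 2 * (1 + e) / x / 2 * a%:R.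
    have -> : 2 * (1 + e) / x / 2 * a%:R = (1 + e) * a%:R / x by field; lra.
    rewrite ler_pdivlMr //.
    have -> : (y / 2 + z / 2 - 1) * x = (1 + e) * (x * y / 2) - x by rewrite /y /z; field.
    have : 0 <= (1 + e) * (a%:R - (x * y / 2 - 1)) by rewrite mulr_ge0 //; lra.
    by lra.
  by lra.
have fE : f%:R = x - l%:R - d%:R :> R by lra.
have : x * y / 2 < d%:R * (x - l%:R - d%:R).
  by apply: separated_product_gt n0 y0 z0 yyE yx zy lod _ _; lra.
by rewrite -fE ltNge => /negP; apply; apply: (le_trans Rdfa); lra.
Qed.

(** The error is Chebyshev's: variance at most eps n, over the square of eps^2 n / 50. *)
Lemma Pr_alternating_path (R : realType) (n : nat) (e : R) :
  0 < e <= 1 / 50 -> 1000 <= e ^+ 2 * n%:R ->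
  1 - 2500 / (e ^+ 3 * n%:R) <= Pr (2 * (1 + e) / n%:R)
    [set g : cgraph n | exists (v : 'I_n) (s : seq 'I_n),
      alternating_path g v s /\ e ^+ 2 * n%:R / 5 <= (size s)%:R :> R] <= 1.
Proof.
move=> /[dup] e01 /andP[e0 e1] big; set A := [set g | _].
have n1000 : 1000 <= n%:R :> R.
  have : e ^+ 2 * n%:R <= 1 * n%:R by rewrite ler_wpM2r // expr_le1 //; lra.
  by lra.
have n0 : 0 < n%:R :> R by lra.
set p := _ / n%:R.
have p01 : 0 <= p <= 1.
  by rewrite /p ler_pdivrMr // divr_ge0 //; lra.
rewrite Pr_Ex; apply/andP; split; last first.
  by rewrite -{2}(Ex_cst n p 1); apply: le_Ex => // g; case: `[< _ >].
pose delta := e ^+ 2 * n%:R / 50.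
have d0 : 0 < delta by rewrite /delta; lra.
pose N0 := Num.truncn (e * n%:R ^+ 2 / 2).
pose m := (n %/ 3)%N.
have mn : (m <= n)%N := leq_div n 3.
pose k := potential (dfs_init n).
apply: (@le_trans _ _ (1 - p / 2 * N0%:R / delta ^+ 2)).
  rewrite lerD2l lerN2 ler_pdivrMr ?exprn_gt0 //.
  have -> : 2500 / (e ^+ 3 * n%:R) * delta ^+ 2 = e * n%:R.
    by rewrite /delta; field; rewrite !gt_eqF.
  have Nle : N0%:R <= e * n%:R ^+ 2 / 2.
    by rewrite Num.Theory.truncn_le // divr_ge0 ?mulr_ge0 ?ltW.
  have -> : p / 2 * N0%:R = (1 + e) * N0%:R / n%:R by rewrite /p; field; rewrite gt_eqF.
  rewrite ler_pdivrMr //.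
  have : 0 <= (2 - (1 + e)) * N0%:R by rewrite mulr_ge0 //; lra.
  by lra.
have dev := @excess_deviation R n m N0 k p delta p01 d0.
rewrite lerBlDr; apply: le_trans (lerD (lexx _) dev).
(* Pointwise, the path exists or the success count deviates, so the two indicators sum to at least
   1. *)
rewrite -ExD -{1}(Ex_cst n p 1); apply: le_Ex => // g.
have [is_ hs] := dfs_final N0 g mn.
set s := run _ _ _ _ _ in is_ hs *.
case: (asboolP (A g)) => [_|nA]; first by rewrite lerDl.
rewrite add0r (_ : _ < _ = true) //.
have [nd dfl] := ndoneE is_.
apply: (short_stack_deviation (d := ndone s) (f := #|fresh s|) (l := size (stk s))) => //.
- exact: inv_hits is_.
- exact: inv_ndone is_.
- exact: ndone_fresh_asked is_.
- exact: inv_asked is_.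
- exact/orP.
(* A stack of k vertices is a path with k - 1 edges, hence the + 1 in the threshold. *)
rewrite ltNge; apply/negP => long; apply: nA.
have := inv_uniq is_; have := inv_alternating is_.
case: (stk s) long => [|v l] long al un.
  by move: long; rewrite /=; lra.
exists v, l; split; first exact: alternating_alternating_path.
by move: long; rewrite /= -natr1; lra.
Qed.

(** Some bound on [eps] is unavoidable: once [eps n ^+ 2 >= 5], the required length is at least n,
    more than any path has. *)
Theorem lemma4p1 (R : realType) :
  exists2 eps0 : R, 0 < eps0 &
    forall eps : nat -> R,
      (forall n, 0 < eps n) ->
      (\forall n \near \oo, eps n <= eps0) ->
      much_greater eps
        (fun n => n%:R `^ (- (1 / 3)) * (ln n%:R) `^ (1 / 3)) ->
      whp
        (fun n => [set g : cgraph n |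
           exists (v : 'I_n) (s : seq 'I_n),
             alternating_path g v s /\
             eps n ^+ 2 * n%:R / 5 <= (size s)%:R :> R])
        (fun n => 2 * (1 + eps n) / n%:R).
Proof.
exists (1 / 50); first by lra.
move=> eps eps_gt0 eps_le /cvgryPge big.
apply/cvgrPdist_le => r r0.
(* The summand 1000 will give eps^2 n >= 1000, and 2500 / r makes the failure probability at most
   r. *)
pose K : R := 1000 + 2500 / r.
have K1 : 1000 <= K by rewrite /K lerDl divr_ge0 ?ler0n ?(ltW r0).
near=> n.
have e0 := eps_gt0 n.
have e1 : eps n <= 1 / 50 by near: n.
have Kle : K <= eps n / (n%:R `^ (- (1 / 3)) * (ln n%:R) `^ (1 / 3)).
  by near: n; apply: big.
have nexp : expR 1 <= n%:R :> R by near: n; exact: nbhs_infty_ger.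
have n0 : 0 < n%:R :> R by apply: lt_le_trans nexp; exact: expR_gt0.
have ln1 : 1 <= ln n%:R :> R by rewrite -[leLHS]expRK ler_ln ?posrE ?expR_gt0.
have cube (x : R) t : 0 <= x -> (x `^ t) ^+ 3 = x `^ (t * 3).
  by move=> x0; rewrite -powR_mulrn ?powR_ge0 // powRrM.
(* Cubing the growth hypothesis gives K^3 ln n <= eps^3 n, and ln n is at least 1. *)
have K3 : K ^+ 3 <= eps n ^+ 3 * n%:R.
  have b0 : 0 < n%:R `^ (- (1 / 3)) * (ln n%:R) `^ (1 / 3) :> R.
    by rewrite mulr_gt0 ?powR_gt0 //; lra.
  move: Kle; rewrite ler_pdivlMr // => Kle.
  have : (K * (n%:R `^ (- (1 / 3)) * (ln n%:R) `^ (1 / 3))) ^+ 3 <= eps n ^+ 3.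
    by rewrite ler_pXn2r // nnegrE ?mulr_ge0 ?powR_ge0 //; lra.
  have lnge0 : 0 <= ln n%:R :> R by lra.
  rewrite !exprMn !cube ?(ltW n0) //.
  have -> : - (1 / 3) * 3 = -1 :> R by field.
  have -> : 1 / 3 * 3 = 1 :> R by field.
  rewrite powRr1 // powR_inv1 ?(ltW n0) // mulrCA ler_pdivrMl // => h.
  rewrite [leRHS]mulrC.
  by apply: le_trans h; rewrite ler_peMr // exprn_ge0 //; lra.
have K2 : K <= eps n ^+ 3 * n%:R.
  by apply: le_trans K3; rewrite ler_eXnr //; lra.
have e2 : 1000 <= eps n ^+ 2 * n%:R.
  apply: (le_trans K1); apply: (le_trans K2); rewrite exprSr -mulrA ler_wpM2l ?exprn_ge0 //.
    by lra.
  by rewrite ger_pMl //; lra.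
have e01 : 0 < eps n <= 1 / 50 by rewrite e0.
have /andP[lb ub] := Pr_alternating_path e01 e2.
rewrite ger0_norm ?subr_ge0 //.
have x0 : 0 < eps n ^+ 3 * n%:R by rewrite mulr_gt0 ?exprn_gt0.
have : 2500 / (eps n ^+ 3 * n%:R) <= r.
  rewrite ler_pdivrMr //; apply: (@le_trans _ _ (r * K)); last by rewrite ler_pM2l.
  by rewrite /K mulrDr mulrCA divff ?gt_eqF // mulr1 lerDr mulr_ge0 ?(ltW r0) ?ler0n.
by move: lb; lra.
Unshelve. all: by end_near.
Qed.
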